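(* Let $\Lambda=(\lambda_n)_{n\in\mathbb{N}^*}$ be a sequence of positive real numbers which is ultimately strictly increasing and satisfies $\lim_{n\to\infty}\lambda_n=+\infty$. Assume that there exist an integer $p\ge 1$ and non-negative constants $a_0,a_1,\dots,a_{p-1}$ such that $$\lim_{k\to\infty}\left(\lambda_{kp+j+1}-\lambda_{kp+j}\right)=a_j\qquad\text{for all } j=0,1,\dots,p-1,$$ and assume in addition that $\sum_{j=0}^{p-1}a_j>0$. Then the asymptotic density $d(\Lambda)$ exists and $$d(\Lambda)=b(\Lambda)=\frac{p}{\sum_{j=0}^{p-1}a_j},$$ where $b(\Lambda)$ is the Beurling-Malliavin density of $\Lambda$.
   Context: $\mathbb{N}^*=\{1,2,3,\dots\}$. For a sequence $\Lambda=(\lambda_n)_{n\in\mathbb{N}^*}$ of positive real numbers, ultimately strictly increasing, with $\lambda_n\to+\infty$: (1) The counting function is $F_\Lambda(t)=\#\{k\in\mathbb{N}^*:\lambda_k\le t\}$ for $t>0$, and $F_\Lambda(0)=0$. The lower and upper asymptotic densities are $\underline d(\Lambda)=\liminf_{n\to\infty}F_\Lambda(n)/n$ and $\overline d(\Lambda)=\limsup_{n\to\infty}F_\Lambda(n)/n$. If they are equal, $\Lambda$ is said to have asymptotic density $d(\Lambda)=\underline d(\Lambda)=\overline d(\Lambda)$. (2) The Beurling-Malliavin density $b(\Lambda)\in[0,+\infty]$ is the infimum of the numbers $a\ge 0$ for which there exists a sequence $(n_k)_{k\in\mathbb{N}^*}$ of distinct positive integers such that $\sum_{k=1}^\infty\left|\frac{1}{\lambda_k}-\frac{a}{n_k}\right|<\infty$;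 if no such $a$ exists, $b(\Lambda)=+\infty$. *)

(* Defs.v *)
From HB Require Import structures.
From mathcomp Require Import all_boot all_order all_algebra.
From mathcomp Require Import all_classical all_reals all_analysis.
Set Implicit Arguments.
Unset Strict Implicit.
Unset Printing Implicit Defensive.
Import Order.TTheory GRing.Theory Num.Theory.
Import numFieldNormedType.Exports.
Local Open Scope classical_set_scope.
Local Open Scope ring_scope.

(* A sequence indexed by the positive integers is a function on nat whose
   value at 0 is never used. *)

Definition counting_function (R : realType) (lam : nat -> R) (t : R) : \bar R :=
  if 0 < t then counting [set k : nat | (0 < k)%N /\ lam k <= t] else 0%E.

Definition lower_density (R : realType) (lam : nat -> R) : \bar R :=
  limn_einf (fun n => counting_function lam n%:R / n%:R%:E)%E.

Definition upper_density (R : realType) (lam : nat -> R) : \bar R :=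
  limn_esup (fun n => counting_function lam n%:R / n%:R%:E)%E.

Definition has_asymptotic_density (R : realType) (lam : nat -> R) : Prop :=
  lower_density lam = upper_density lam.

(* Only meaningful when [has_asymptotic_density lam] holds. *)
Definition asymptotic_density (R : realType) (lam : nat -> R) : \bar R :=
  lower_density lam.

(* The sum of non-negative terms is taken in the extended reals, so absolute
   convergence means that it is not +oo; ereal_inf of the empty set is +oo. *)
Definition beurling_malliavin_density (R : realType) (lam : nat -> R) : \bar R :=
  ereal_inf [set a%:E | a in [set a : R | 0 <= a /\
    exists m : nat -> nat,
      [/\ forall k, (0 < k)%N -> (0 < m k)%N,
          forall i j, (0 < i)%N -> (0 < j)%N -> m i = m j -> i = j &
          (\sum_(1 <= k <oo) (`|(lam k)^-1 - a / (m k)%:R|)%:E < +oo)%E]]].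

(* Main.v *)
Require Import Defs.
From HB Require Import structures.
From mathcomp Require Import all_boot all_order all_algebra.
From mathcomp Require Import all_classical all_reals all_analysis.
From mathcomp Require Import ring lra.
Set Implicit Arguments.
Unset Strict Implicit.
Unset Printing Implicit Defensive.
Import Order.TTheory GRing.Theory Num.Theory.
Import numFieldNormedType.Exports.
Local Open Scope classical_set_scope.
Local Open Scope ring_scope.

(** Put S = a_0 + ... + a_(p-1) and D = p / S. Everything rests on two facts
    about the sequence: n / lam n tends to D, and the increments
    lam (n+1) - lam n are eventually bounded. The second is immediate. For the
    first, the increments over blocks of length p, lam ((k+1)p) - lam (kp), tend
    to S, so lam (kp) / k tends to S by Cesaro, and bounded increments carry this
    from the multiples of p to all indices ([cvg_ratio_of_blocks]).

    The asymptotic density is D because k <= (D - e) n forces lam k <= n and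
    lam k <= n forces k <= (D + e) n, for all but finitely many k
    ([cvg_counting_function_ratio]).

    No a < D is admissible for the Beurling-Malliavin density: the integers n_k
    being distinct, the sum of 1/n_k for k <= K is at most the harmonic sum H_K,
    so summability gives sum_(k <= K) 1/lam k <= a H_K + O(1), whereas
    1/lam k >= c/k eventually for some c > a; this contradicts the divergence of
    H_K ([le_of_summable_comparison]).

    Every a > D is admissible: over a block of length p the sequence a lam
    eventually increases by at least p, since its increment tends to a S > p.
    There is thus room to assign to the indices of the q-th block the
    consecutive integers that start at the integer part of a lam (qp). The
    integers obtained are distinct and stay at bounded distance from a lam k, so
    |1/lam k - a/n_k| = O(1/k^2) ([exists_summable_comparison]). *)

Lemma cvg_eventually_eq (R : realType) (f g : nat -> R) (l : R) :
  f n @[n --> \oo] --> l -> (\forall n \near \oo, f n = g n) ->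
  g n @[n --> \oo] --> l.
Proof.
move=> fl fg; apply: cvg_trans fl; apply: near_eq_cvg.
by apply: filterS fg => n ->.
Qed.

(** * Growth of sequences with bounded increments *)

Lemma cvg_bounded_div (R : realType) (w : nat -> R) (C : R) :
  (\forall n \near \oo, `|w n| <= C) -> w n / n%:R @[n --> \oo] --> 0.
Proof.
move=> wC; apply/cvgrPdist_le => e e0; near=> n.
have n0 : 0 < n%:R :> R by rewrite ltr0n; near: n; exact: nbhs_infty_gt.
rewrite sub0r normrN normrM normfV (ger0_norm (ltW n0)) ler_pdivrMr //.
apply: (@le_trans _ _ C); first by near: n.
by rewrite mulrC -ler_pdivrMr //; near: n; exact: nbhs_infty_ger.
Unshelve. all: by end_near. Qed.

(** Eventual properties can be checked on each residue class modulo p, because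
    there are finitely many classes. *)
Lemma near_residues (p : nat) (P : set nat) : (0 < p)%N ->
  (forall j : 'I_p, \forall k \near \oo, P (k * p + j)%N) ->
  \forall n \near \oo, P n.
Proof.
move=> p0 /filter_forall /(cvg_divnr _ p0) Pj.
near=> n; rewrite (divn_eq n p); move: (ltn_pmod n p0) => np.
suff : forall j : 'I_p, P (n %/ p * p + j)%N by move=> /(_ (Ordinal np)).
by near: n; exact: Pj.
Unshelve. all: by end_near. Qed.

Lemma dist_bounded_increments (R : realType) (u : nat -> R) (M : R) (N : nat) :
  (forall n, (N <= n)%N -> `|u n.+1 - u n| <= M) ->
  forall n j, (N <= n)%N -> `|u (n + j)%N - u n| <= M * j%:R.
Proof.
move=> uM n j Nn; elim: j => [|j IH]; first by rewrite addn0 subrr normr0 mulr0.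
rewrite addnS -natr1 mulrDr mulr1 [_ + M]addrC.
apply: le_trans (ler_distD (u (n + j)%N) _ _) _.
by apply: lerD => //; apply: uM; rewrite (leq_trans Nn) // leq_addr.
Qed.

(** Cesaro's lemma for the increments of v, whose partial sums telescope to
    v (k + 1) - v 0. *)
Lemma cvg_ratio_of_increments (R : realType) (v : nat -> R) (l : R) :
  v k.+1 - v k @[k --> \oo] --> l -> v k / k%:R @[k --> \oo] --> l.
Proof.
move=> /cesaro vl.
have v0 : v 0%N * harmonic n @[n --> \oo] --> v 0%N * 0.
  exact: (cvgM (cvg_cst _) cvg_harmonic).
suff : v n.+1 / n.+1%:R @[n --> \oo] --> l + v 0%N * 0.
  by rewrite mulr0 addr0 (cvg_shiftS (fun k => v k / k%:R)).
apply: (cvg_eventually_eq (cvgD vl v0)); near=> n.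
rewrite /= /arithmetic_mean /= seriesEnat /= telescope_sumr //.
by rewrite [v 0%N * _]mulrC -mulrDr subrK mulrC.
Unshelve. all: by end_near. Qed.

(** With q = n / p (Euclidean quotient), split
    u n / n = (u n - u (qp)) / n + (u (qp) / q) (q / n). The first term has a
    bounded numerator, and the product tends to l times 1/p. *)
Lemma cvg_ratio_of_blocks (R : realType) (u : nat -> R) (p : nat) (l M : R) :
  (0 < p)%N ->
  (\forall n \near \oo, `|u n.+1 - u n| <= M) ->
  u (k.+1 * p)%N - u (k * p)%N @[k --> \oo] --> l ->
  u n / n%:R @[n --> \oo] --> l / p%:R.
Proof.
move=> p0 [N _ uM] /(@cvg_ratio_of_increments _ (fun k => u (k * p)%N)) ul.
have p0R : p%:R != 0 :> R by rewrite pnatr_eq0 -lt0n.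
have rest : (u n - u (n %/ p * p)%N) / n%:R @[n --> \oo] --> 0.
  apply: (@cvg_bounded_div _ _ (`|M| * p%:R)); near=> n.
  have Nq : (N <= n %/ p * p)%N.
    near: n; exact: (cvg_divnr _ p0 _ (cvg_mulnr _ p0 _ (nbhs_infty_ge N))).
  rewrite [X in u X - _](divn_eq n p).
  apply: (le_trans (dist_bounded_increments uM _ Nq)).
  apply: (@le_trans _ _ (`|M| * (n %% p)%:R)).
    by rewrite ler_wpM2r // ler_norm.
  by rewrite ler_wpM2l // ler_nat ltnW // ltn_pmod.
have quot : (n %/ p)%:R / n%:R @[n --> \oo] --> (p%:R : R)^-1.
  have residue : (n %% p)%:R / p%:R / n%:R @[n --> \oo] --> (0 : R).
    apply: (@cvg_bounded_div _ _ 1); near=> n.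
    rewrite ger0_norm ?divr_ge0 // ler_pdivrMr ?ltr0n // mul1r.
    by rewrite ler_nat ltnW // ltn_pmod.
  rewrite -[X in _ --> X]subr0.
  apply: (cvg_eventually_eq (cvgB (cvg_cst _) residue)); near=> n => /=.
  have n0 : n%:R != 0 :> R.
    by rewrite pnatr_eq0 -lt0n; near: n; exact: nbhs_infty_gt.
  have := congr1 (fun m => m%:R : R) (divn_eq n p); rewrite natrD natrM => nE.
  apply: (mulfI p0R); rewrite mulrBr divff // mulrC -!mulrA.
  apply: (mulfI n0); rewrite mulrBr mulr1 {1}nE; field.
  by rewrite n0 p0R.
rewrite -[X in _ --> X]add0r.
apply: (cvg_eventually_eq (cvgD rest
  (cvgM (cvg_comp _ _ (cvg_divnr _ p0) ul) quot))); near=> n => /=.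
have n0 : n%:R != 0 :> R.
  by rewrite pnatr_eq0 -lt0n; near: n; exact: nbhs_infty_gt.
have q0 : (n %/ p)%:R != 0 :> R.
  rewrite pnatr_eq0 -lt0n; near: n; exact: (cvg_divnr _ p0 _ (nbhs_infty_gt 0)).
by field; rewrite n0 q0.
Unshelve. all: by end_near. Qed.

(** * The counting function *)

Lemma counting_le_nat (R : realType) (A : set nat) (m : nat) :
  A `<=` `I_m -> exists2 c : nat, counting A = c%:R%:E :> \bar R & (c <= m)%N.
Proof.
move=> Am; have fA : finite_set A by apply: sub_finite_set Am _; exact: finite_II.
rewrite /counting asboolT //; eexists; first by [].
by apply: geq_card_fset_set; exact: subset_card_le.
Qed.

Lemma counting_II (R : realType) (m : nat) :
  counting `I_m = m%:R%:E :> \bar R.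
Proof.
rewrite /counting asboolT; last exact: finite_II.
by rewrite (card_fset_set (n := m)) //; exact: card_eqxx.
Qed.

Lemma counting_ge_interval (R : realType) (A : set nat) (N m : nat) :
  `I_m `\` `I_N `<=` A -> (m%:R%:E - N%:R%:E <= counting A :> \bar R)%E.
Proof.
move=> mNA; rewrite leeBlDr // -!counting_II.
apply: (@le_trans _ _ (counting (A `|` `I_N))).
  apply: le_measure; rewrite ?inE //= => k km.
  have [kN|kN] := pselect (`I_N k); first by right.
  by left; apply: mNA.
exact: measureU2.
Qed.

(** Since n / lam n tends to D, the condition lam k <= n lies between
    k <= (D - e) n and k <= (D + e) n except for k below a threshold N that
    does not depend on n; these exceptions change the count by at most N. *)
Lemma cvg_counting_function_ratio (R : realType) (lam : nat -> R) (D : R) :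
  (forall n, (0 < n)%N -> 0 < lam n) ->
  n%:R / lam n @[n --> \oo] --> D ->
  (counting_function lam n%:R / n%:R%:E)%E @[n --> \oo] --> D%:E.
Proof.
move=> lam0 lamD; have D0 : 0 <= D.
  rewrite -(cvg_lim _ lamD) //; apply: limr_ge; first by apply: cvgP lamD.
  by near=> n; rewrite divr_ge0 // ltW // lam0 //; near: n; exact: nbhs_infty_gt.
pose A n := [set k : nat | (0 < k)%N /\ lam k <= n%:R].
have cA n : (0 < n)%N -> counting_function lam n%:R = counting (A n).
  by move=> n0; rewrite /counting_function ltr0n n0.
have bounds e : 0 < e -> exists N : nat, forall n, (0 < n)%N ->
  exists2 c : nat, counting (A n) = c%:R%:E :> \bar R &
    (D - e) * n%:R - N%:R <= c%:R <= (D + e) * n%:R + N%:R.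
  move=> e0.
  have /cvgrPdist_le/(_ e e0)[N _ HN] := lamD.
  exists N.+1 => n n0.
  have De : 0 <= (D + e) * n%:R by rewrite mulr_ge0 // addr_ge0 // ltW.
  have near_ratio k : (N <= k)%N -> (0 < k)%N ->
      (D - e) * lam k <= k%:R <= (D + e) * lam k.
    move=> Nk k0; have /= := HN k Nk.
    by rewrite distrC ler_distl ler_pdivlMr ?ler_pdivrMr ?lam0.
  have upper : A n `<=` `I_(N + (Num.trunc ((D + e) * n%:R)).+1).
    move=> k [k0 kn] /=; have [kN|Nk] := ltnP k N; first by rewrite ltn_addr.
    rewrite addnS ltnS (leq_trans _ (leq_addl _ _)) // truncn_ge_nat //.
    have /andP[_ /le_trans] := near_ratio k Nk k0; apply.
    by rewrite ler_wpM2l // addr_ge0 // ltW.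
  have lower : `I_(Num.trunc ((D - e) * n%:R)).+1 `\` `I_N.+1 `<=` A n.
    move=> k [/= kt /negP]; rewrite -leqNgt => Nk.
    have k0 : (0 < k)%N by exact: leq_ltn_trans Nk.
    (* Truncation sends negative numbers to 0, which the positive k excludes. *)
    have Den : 0 <= (D - e) * n%:R.
      rewrite leNgt; apply/negP => De_lt0.
      have t0 : (0 < Num.trunc ((D - e) * n%:R))%N by exact: leq_trans k0 _.
      by move: t0; rewrite truncn_gt0 leNgt (lt_trans De_lt0).
    split=> //.
    rewrite ltnS truncn_ge_nat // in kt.
    have De0 : 0 < D - e.
      by rewrite -(pmulr_lgt0 _ (ltr0Sn R n.-1)) prednK // (lt_le_trans _ kt) // ltr0n.
    have /andP[/le_trans/(_ kt) + _] := near_ratio k (ltnW Nk) k0.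
    by rewrite ler_pM2l.
  have [c cE cle] := counting_le_nat R upper.
  exists c => //; apply/andP; split.
    have := counting_ge_interval R lower; rewrite cE -EFinB lee_fin.
    by apply: le_trans; rewrite lerB // ltW // truncnS_gt.
  rewrite -(ler_nat R) in cle; apply: le_trans cle _.
  (* N.+1 was taken as threshold to absorb the off-by-one of the truncation. *)
  rewrite -addSnnS natrD addrC lerD2r.
  by rewrite truncn_le.
apply/fine_cvgP; split.
  near=> n; have n0 : (0 < n)%N by near: n; exact: nbhs_infty_gt.
  have [N /(_ n n0)[c cE _]] := bounds 1 ltr01.
  by rewrite cA // cE inver pnatr_eq0 (negbTE (lt0n_neq0 n0)).
apply/cvgrPdist_le => e e0; have e20 : 0 < e / 2 by rewrite divr_gt0.
have [N HN] := bounds _ e20; near=> n.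
have n0 : (0 < n)%N by near: n; exact: nbhs_infty_gt.
have n0R : 0 < n%:R :> R by rewrite ltr0n.
have [c cE /andP[cge cle]] := HN n n0.
have Nn : N%:R <= e / 2 * n%:R.
  by rewrite mulrC -ler_pdivrMr //; near: n; exact: nbhs_infty_ger.
rewrite /= cA // cE inver (gt_eqF n0R) /=.
rewrite distrC ler_distl ler_pdivlMr // ler_pdivrMr //.
by apply/andP; split; nra.
Unshelve. all: by end_near. Qed.

(** * Lower bound for the Beurling-Malliavin density *)

(** Admissibility of a in the Beurling-Malliavin density, with its witness m. *)
Definition summable_comparison (R : realType) (lam : nat -> R) (a : R)
    (m : nat -> nat) : Prop :=
  [/\ forall k, (0 < k)%N -> (0 < m k)%N,
      forall i j, (0 < i)%N -> (0 < j)%N -> m i = m j -> i = j &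
      (\sum_(1 <= k <oo) (`|(lam k)^-1 - a / (m k)%:R|)%:E < +oo)%E].

(** By induction on the size: some element of s is at least the size of s, so
    its inverse is at most the last term of the harmonic sum, and it can be
    removed. *)
Lemma sum_inv_uniq_le_harmonic (R : realType) (s : seq nat) :
  uniq s -> all (leq 1) s ->
  \sum_(i <- s) (i%:R)^-1 <= \sum_(1 <= i < (size s).+1) (i%:R)^-1 :> R.
Proof.
move sE: (size s) => n; elim: n s sE => [|n IH] s sE us s0.
  by move/size0nil: sE => ->; rewrite big_nil.
(* n + 1 distinct positive integers cannot all be at most n *)
have [x xs nx] : exists2 x, x \in s & (n < x)%N.
  apply/hasP/negP => /negP/hasPn sn.
  have : (size s <= size (iota 1 n))%N.
    apply: uniq_leq_size => // x xs; rewrite mem_iota add1n ltnS (allP s0) //=.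
    by rewrite leqNgt sn.
  by rewrite size_iota sE ltnn.
rewrite (perm_big _ (perm_to_rem xs)) /= big_cons big_nat_recr //= addrC.
apply: lerD; last by rewrite lef_pV2 ?posrE ?ltr0n ?ler_nat // (leq_trans _ nx).
apply: IH; [by rewrite size_rem // sE | exact: rem_uniq|].
by apply/allP => y /mem_rem/(allP s0).
Qed.

Lemma sum_inv_nat_unbounded (R : realType) (M : R) :
  exists K : nat, M < \sum_(1 <= k < K.+1) k%:R^-1.
Proof.
apply: contrapT => /forallNP bounded; apply: (@dvg_harmonic R).
apply: nondecreasing_is_cvgn.
  by apply: nondecreasing_series => n _ _; exact: harmonic_ge0.
exists M => _ [K _ <-]; rewrite leNgt; apply/negP => MK; apply: (bounded K).
by rewrite big_add1 /= in MK *.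
Qed.

(** The terms from some index on only decrease the partial sums; the finitely
    many others contribute at most the sum of their absolute values. *)
Lemma sum_bounded_of_near_le0 (R : realType) (f : nat -> R) :
  (\forall n \near \oo, f n <= 0) ->
  exists B : R, forall K, \sum_(1 <= k < K.+1) f k <= B.
Proof.
move=> [N _ fN]; exists (\sum_(1 <= k < N.+1) `|f k|) => K.
have [KN|NK] := leqP K N.
  rewrite (@big_cat_nat _ _ _ K.+1 1 N.+1) //= ler_wpDr ?sumr_ge0 //.
  by apply: ler_sum => k _; exact: ler_norm.
rewrite (@big_cat_nat _ _ _ N.+1 1 K.+1) //=; last by rewrite ltnS ltnW.
rewrite -[leRHS]addr0 lerD //; first by apply: ler_sum => k _; exact: ler_norm.
rewrite big_nat; apply: sumr_le0 => k /andP[Nk _].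
by apply: fN; rewrite /= ltnW.
Qed.

(** If a < c < D, then (c - a) H_K would be bounded: c H_K is at most the K-th
    partial sum of 1/lam up to a constant, that sum is at most a times the sum of
    the 1/m_k up to a constant, and the latter sum is at most H_K. *)
Lemma le_of_summable_comparison (R : realType) (lam : nat -> R) (D a : R)
    (m : nat -> nat) :
  (forall n, (0 < n)%N -> 0 < lam n) ->
  n%:R / lam n @[n --> \oo] --> D -> 0 <= a ->
  summable_comparison lam a m -> D <= a.
Proof.
move=> lam0 lamD a0 [m0 m_inj sum_fin]; rewrite leNgt; apply/negP => aD.
pose t k := (lam k)^-1 - a / (m k)%:R.
have [T HT] : exists T : R, forall K, \sum_(1 <= k < K.+1) `|t k| <= T.
  exists (fine (\sum_(1 <= k <oo) (`|t k|)%:E)%E) => K.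
  rewrite -lee_fin fineK; last first.
    rewrite ge0_fin_numE //; apply: nneseries_ge0 => n _ _.
    by rewrite lee_fin.
  by rewrite -sumEFin; apply: nneseries_lim_ge => n _ _; rewrite lee_fin.
pose c := (a + D) / 2.
have [ac cD] : a < c /\ c < D by rewrite /c; split; lra.
have sum_m K :
    \sum_(1 <= k < K.+1) (m k)%:R^-1 <= \sum_(1 <= k < K.+1) k%:R^-1 :> R.
  have := @sum_inv_uniq_le_harmonic R [seq m k | k <- index_iota 1 K.+1].
  rewrite big_map size_map size_iota subn1 /=; apply.
    rewrite map_inj_in_uniq ?iota_uniq // => i j.
    by rewrite !mem_index_iota => /andP[i0 _] /andP[j0 _]; exact: m_inj.
  by apply/allP => _ /mapP[k + ->]; rewrite mem_index_iota => /andP[/m0].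
have [B HB] : exists B : R, forall K,
    \sum_(1 <= k < K.+1) (c / k%:R - (lam k)^-1) <= B.
  apply: sum_bounded_of_near_le0; near=> k.
  have k0 : (0 < k)%N by near: k; exact: nbhs_infty_gt.
  rewrite subr_le0 ler_pdivrMr ?ltr0n // mulrC.
  by near: k; exact: cvgr_ge _ lamD _ cD.
have [K] := @sum_inv_nat_unbounded R ((T + B) / (c - a)).
rewrite ltNge => /negP; apply.
rewrite ler_pdivlMr ?subr_gt0 //.
have : \sum_(1 <= k < K.+1) (lam k)^-1 <=
    \sum_(1 <= k < K.+1) `|t k| + a * \sum_(1 <= k < K.+1) (m k)%:R^-1.
  rewrite mulr_sumr -big_split /= ler_sum // => k _.
  by rewrite -lerBlDr ler_norm.
move: (HB K) (HT K) (ler_wpM2l a0 (sum_m K)).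
by rewrite sumrB -mulr_sumr => h1 h2 h3 h4; lra.
Unshelve. all: by end_near. Qed.

(** * Upper bound for the Beurling-Malliavin density *)

(** Comparison with the telescoping series of
    2 (1/k - 1/(k+1)) = 2 / (k (k+1)) >= 1/k^2. *)
Lemma nneseries_lt_pinfty_of_inv_square (R : realType) (t : nat -> R) (C : R) :
  (forall k, 0 <= t k) -> (\forall k \near \oo, t k <= C / k%:R ^+ 2) ->
  (\sum_(1 <= k <oo) (t k)%:E < +oo)%E.
Proof.
move=> t0 tC; pose g k : R := k%:R^-1.
have [B HB] : exists B : R, forall K,
    \sum_(1 <= k < K.+1) (t k + 2 * `|C| * (g k.+1 - g k)) <= B.
  apply: sum_bounded_of_near_le0; near=> k.
  have k0 : 0 < k%:R :> R by rewrite ltr0n; near: k; exact: nbhs_infty_gt.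
  have k1 : 1 <= k%:R :> R by rewrite ler1n -(ltr0n R).
  have tk : t k <= C / k%:R ^+ 2 by near: k.
  rewrite -[_ - _]opprB mulrN subr_le0; apply: le_trans tk _.
  apply: (@le_trans _ _ (`|C| / k%:R ^+ 2)).
    by rewrite ler_wpM2r ?invr_ge0 ?exprn_ge0 ?ler_norm // ltW.
  rewrite [2 * _]mulrC -mulrA; apply: ler_wpM2l => //.
  have k2 : 0 < k%:R + 1 :> R by rewrite addr_gt0.
  rewrite -subr_ge0 /g -[k.+1%:R]natr1.
  have -> : 2 * (k%:R^-1 - (k%:R + 1)^-1) - (k%:R ^+ 2)^-1
      = (k%:R - 1) / (k%:R ^+ 2 * (k%:R + 1)) :> R.
    by field; rewrite !gt_eqF.
  by rewrite divr_ge0 ?subr_ge0 // mulr_ge0 ?exprn_ge0 // ltW.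
have sums K : \sum_(1 <= k < K.+1) t k <= B + 2 * `|C|.
  have := HB K; rewrite big_split /= -mulr_sumr telescope_sumr // /g invr1.
  have C0 : 0 <= 2 * `|C| by rewrite mulr_ge0.
  have : 0 <= 2 * `|C| * (K.+1%:R)^-1 by rewrite mulr_ge0 // invr_ge0.
  by rewrite mulrBr mulr1; set x := _ / _; set S := bigop _ _ _; lra.
apply: (@le_lt_trans _ _ (B + 2 * `|C|)%:E); last exact: ltry.
apply: lime_le.
  by apply: is_cvg_nneseries => k _ _; rewrite lee_fin.
near=> n; rewrite sumEFin lee_fin.
have n0 : (0 < n)%N by near: n; exact: nbhs_infty_gt.
by rewrite -(prednK n0).
Unshelve. all: by end_near. Qed.

(** Write k = qp + r with r < p. From the Q-th block on, m k is the integer part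
    of a lam (qp), plus r: the increment of a lam over a block is at least p, so
    the next block starts beyond the p integers used by this one. Before that,
    m k = k; the values do not collide, because n <= a lam n at n = Qp. Thus m is
    strictly increasing, hence m k >= k, and |m k - a lam k| is bounded as lam
    moves by a bounded amount within a block. The general term
    |m k - a lam k| / (lam k * m k) is then O(1/k^2). *)
Lemma exists_summable_comparison (R : realType) (lam : nat -> R) (a M : R)
    (p : nat) :
  (0 < p)%N -> 0 < a ->
  (forall n, (0 < n)%N -> 0 < lam n) ->
  (\forall n \near \oo, `|lam n.+1 - lam n| <= M) ->
  (\forall k \near \oo, p%:R <= a * (lam (k.+1 * p)%N - lam (k * p)%N)) ->
  (\forall n \near \oo, n%:R <= a * lam n) ->
  exists m, summable_comparison lam a m.
Proof.
move=> p0 a0 lam0 [Q1 _ lamM] [Q2 _ lam_block] [Q3 _ lam_ge].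
pose Q := maxn Q1 (maxn Q2 Q3).
have Q123 n : (Q <= n)%N -> [/\ (Q1 <= n)%N, (Q2 <= n)%N & (Q3 <= n)%N].
  by rewrite !geq_max => /and3P.
have QQp : (Q <= Q * p)%N by rewrite leq_pmulr.
pose base q := Num.trunc (a * lam (q * p)%N).
have alam_ge0 q : (Q <= q)%N -> 0 <= a * lam (q * p)%N.
  move=> Qq; apply: le_trans (lam_ge _ _); first exact: ler0n.
  by have [] := Q123 (q * p)%N (leq_trans Qq (leq_pmulr _ p0)).
have base_step q : (Q <= q)%N -> (base q + p <= base q.+1)%N.
  move=> Qq; rewrite truncn_ge_nat ?alam_ge0 ?leqW // natrD.
  have /= := lam_block q (let: And3 _ h _ := Q123 q Qq in h).
  have : (base q)%:R <= a * lam (q * p)%N by rewrite truncn_le alam_ge0.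
  by rewrite mulrBr; lra.
pose m k := if (k < Q * p)%N then k else (base (k %/ p) + k %% p)%N.
have mE q r : (Q <= q)%N -> (r < p)%N -> m (q * p + r)%N = (base q + r)%N.
  move=> Qq rp; rewrite /m ltnNge (leq_trans _ (leq_addr _ _)) ?leq_mul //=.
  by rewrite divnMDl // divn_small // addn0 modnMDl modn_small.
(* The cases: below block Q, entering block Q, inside a block, and passing
   from a block to the next. *)
have m_step k : (m k < m k.+1)%N.
  have [kQ|Qk] := ltnP k (Q * p).
    rewrite {1}/m kQ; have [kQ1|Qk1] := ltnP k.+1 (Q * p); first by rewrite /m kQ1.
    have -> : k.+1 = (Q * p + 0)%N by rewrite addn0; apply/eqP; rewrite eqn_leq kQ.
    rewrite mE // !addn0 truncn_ge_nat ?alam_ge0 //; apply: lam_ge.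
    by have [] := Q123 _ QQp.
  have Qq : (Q <= k %/ p)%N by rewrite leq_divRL.
  have rp : (k %% p < p)%N by rewrite ltn_pmod.
  rewrite (divn_eq k p) -addnS mE //.
  have [rp1|] := ltnP (k %% p).+1 p; first by rewrite mE // addnS.
  rewrite leq_eqVlt ltnNge rp orbF => /eqP pE.
  have -> : (k %/ p * p + (k %% p).+1 = (k %/ p).+1 * p + 0)%N.
    by rewrite -pE addn0 addnC -mulSn.
  rewrite mE ?leqW // addn0.
  by apply: (leq_trans _ (base_step _ Qq)); rewrite ltn_add2l.
have m_homo : {homo m : i j / (i < j)%N} by exact: homo_ltn ltn_trans m_step.
have m_ge k : (k <= m k)%N.
  by elim: k => // k IH; apply: leq_ltn_trans IH (m_step k).
exists m; split.
- by move=> k k0; apply: leq_trans k0 (m_ge k).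
- move=> i j _ _ mij; case: (ltngtP i j) => // /m_homo; by rewrite mij ltnn.
pose C : R := 1 + p%:R + a * (`|M| * p%:R).
have C0 : 0 <= C by rewrite !addr_ge0 ?mulr_ge0 ?(ltW a0).
apply: (@nneseries_lt_pinfty_of_inv_square _ _ (C * a)) => //.
near=> k.
have k0 : (0 < k)%N by near: k; exact: nbhs_infty_gt.
have Qk : (Q * p <= k)%N by near: k; exact: nbhs_infty_ge.
have lamk := lam0 k k0.
have k0R : 0 < k%:R :> R by rewrite ltr0n.
have mkR : k%:R <= (m k)%:R :> R by rewrite ler_nat.
have mk0 : 0 < (m k)%:R :> R by exact: lt_le_trans mkR.
have close : `|(m k)%:R - a * lam k| <= C.
  have Qq : (Q <= k %/ p)%N by rewrite leq_divRL.
  have rp : (k %% p < p)%N by rewrite ltn_pmod.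
  have mkE : m k = (base (k %/ p) + k %% p)%N by rewrite {1}(divn_eq k p) mE.
  have /andP[b1 b2] := truncn_itv (alam_ge0 _ Qq).
  have Q1q : (Q1 <= k %/ p * p)%N.
    have [+ _ _] := Q123 _ Qq; move/leq_trans; apply; exact: leq_pmulr.
  have := dist_bounded_increments lamM (k %% p) Q1q.
  rewrite -divn_eq => lamd.
  have rpR : (k %% p)%:R <= p%:R :> R by rewrite ler_nat ltnW.
  have {}lamd : `|lam k - lam (k %/ p * p)%N| <= `|M| * p%:R.
    apply: le_trans lamd _; apply: (@le_trans _ _ (`|M| * (k %% p)%:R)).
      by rewrite ler_wpM2r // ler_norm.
    by rewrite ler_wpM2l.
  have {}lamd : `|a * lam k - a * lam (k %/ p * p)%N| <= a * (`|M| * p%:R).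
    by rewrite -mulrBr normrM (gtr0_norm a0) ler_wpM2l // ltW.
  rewrite mkE natrD /C; move: lamd b1 b2 rpR; rewrite -[(Num.trunc _).+1%:R]natr1 -/(base _).
  rewrite !ler_norml => /andP[h1 h2] h3 h4 h5.
  have r0 : 0 <= (k %% p)%:R :> R by exact: ler0n.
  by apply/andP; split; lra.
have -> : (lam k)^-1 - a / (m k)%:R = ((m k)%:R - a * lam k) / (lam k * (m k)%:R).
  by field; rewrite !gt_eqF.
have lm0 : 0 < lam k * (m k)%:R by rewrite mulr_gt0.
rewrite normrM normfV (gtr0_norm lm0) -mulrA.
apply: ler_pM => //; first by rewrite invr_ge0 ltW.
rewrite -(invrK a) -invfM lef_pV2 ?posrE // ?mulr_gt0 ?invr_gt0 ?exprn_gt0 //.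
rewrite expr2 mulrA; apply: ler_pM => //; first by rewrite mulr_ge0 // invr_ge0 ltW.
rewrite mulrC ler_pdivrMr // mulrC; apply: lam_ge.
have [_ _] := Q123 _ QQp; move/leq_trans; exact.
Unshelve. all: by end_near. Qed.

Theorem theorem5p1 (R : realType) (lam : nat -> R)
  (lam_gt0 : forall n, (0 < n)%N -> 0 < lam n)
  (lam_incr : \forall n \near \oo, lam n < lam n.+1)
  (lam_cvg : lam n @[n --> \oo] --> +oo)
  (p : nat) (p_gt0 : (1 <= p)%N)
  (a : 'I_p -> R) (a_ge0 : forall j, 0 <= a j)
  (gap_cvg : forall j : 'I_p,
    lam (k * p + j).+1 - lam (k * p + j)%N @[k --> \oo] --> a j)
  (a_sum : 0 < \sum_(j < p) a j) :
  [/\ has_asymptotic_density lam,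
      asymptotic_density lam = beurling_malliavin_density lam &
      beurling_malliavin_density lam = (p%:R / \sum_(j < p) a j)%:E].
Proof.
set S := \sum_(j < p) a j in a_sum *; set D := p%:R / S.
have p0 : 0 < p%:R :> R by rewrite ltr0n.
have gaps_bounded : \forall n \near \oo, `|lam n.+1 - lam n| <= S + 1.
  apply: (near_residues p_gt0) => j; near=> k.
  have aS : a j <= S by rewrite /S (bigD1 j) //= lerDl sumr_ge0.
  have : `|a j - (lam (k * p + j).+1 - lam (k * p + j)%N)| <= 1.
    by near: k; move: (gap_cvg j) => /cvgrPdist_le; exact.
  have := a_ge0 j.
  by rewrite !ler_norml => a0 /andP[h1 h2]; apply/andP; split; lra.
have blocks : lam (k.+1 * p)%N - lam (k * p)%N @[k --> \oo] --> S.
  have sum_gaps k : \sum_(j < p) (lam (k * p + j).+1 - lam (k * p + j)%N)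
      = lam (k.+1 * p)%N - lam (k * p)%N.
    rewrite -(big_mkord xpredT (fun j => lam (k * p + j).+1 - lam (k * p + j)%N)).
    rewrite (telescope_sumr_eq (fun j => lam (k * p + j)%N)) //; last first.
      by move=> j _; rewrite addnS.
    by rewrite addn0 mulSn addnC.
  under eq_fun do rewrite -sum_gaps.
  by apply: cvg_big => [|j _]; [exact: add_continuous | exact: gap_cvg].
have ratio : n%:R / lam n @[n --> \oo] --> D.
  rewrite /D -invf_div.
  have Sp0 : S / p%:R != 0 by rewrite gt_eqF // divr_gt0.
  apply: (cvg_eventually_eq
    (cvgV Sp0 (cvg_ratio_of_blocks p_gt0 gaps_bounded blocks))).
  by near=> n; rewrite /= invf_div.
have [lower_eq upper_eq] :=
  cvg_limn_einf_sup (cvg_counting_function_ratio lam_gt0 ratio).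
have bm : beurling_malliavin_density lam = D%:E.
  apply/eqP; rewrite eq_le; apply/andP; split; last first.
    apply: le_ereal_inf_tmp => _ [b [b0 [m mP]] <-]; rewrite lee_fin.
    exact: (le_of_summable_comparison lam_gt0 ratio b0 mP).
  apply/lee_addgt0Pr => e e0; rewrite -EFinD.
  have D0 : 0 < D by rewrite divr_gt0.
  have DS : D * S = p%:R by rewrite divfK // gt_eqF.
  have De0 : 0 < D + e by rewrite addr_gt0.
  apply: ereal_inf_lbound; exists (D + e) => //; split; first exact: ltW.
  apply: (@exists_summable_comparison R lam (D + e) (S + 1) p) => //.
    near=> k; rewrite -ler_pdivrMl //; near: k; apply: (cvgr_ge _ blocks).
    by rewrite mulrC ltr_pdivrMr // mulrDr mulrC DS ltrDl mulr_gt0.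
  near=> n; have n0 : (0 < n)%N by near: n; exact: nbhs_infty_gt.
  rewrite -ler_pdivrMr ?lam_gt0 //; near: n; apply: (cvgr_le _ ratio).
  by rewrite ltrDl.
split; last by [].
- by rewrite /has_asymptotic_density /lower_density /upper_density lower_eq.
- by rewrite bm /asymptotic_density /lower_density lower_eq.
Unshelve. all: by end_near. Qed.
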